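(* Let $m\ge 2$, $n\ge 1$, let $\mathcal{D}=\mathrm{diag}(d_1,\dots,d_n)\in T_{m,n}$ be a nonnegative diagonal tensor (all $d_i\ge 0$), and let $\mathcal{A}=(a_{i_1\cdots i_m})\in T_{m,n}$ be a semi-positive tensor. Then: (i) $\beta(\mathcal{A})\le\beta(\mathcal{A}+\mathcal{D})$; (ii) $\beta(\mathcal{A})\le\beta(\mathcal{A}^J_r)$ for all principal sub-tensors $\mathcal{A}^J_r$ of $\mathcal{A}$; (iii) $\beta(\mathcal{A})\le n^{\frac{m-2}{2}}\|T_{\mathcal{A}}\|_\infty$; (iv) $\beta(\mathcal{A})\le\|F_{\mathcal{A}}\|_\infty^{m-1}$ when $m$ is even.
   Context: $T_{m,n}$ is the set of real tensors $\mathcal{A}=(a_{i_1\cdots i_m})$ of order $m$ and dimension $n$, with indices $i_j\in I_n=\{1,\dots,n\}$ and no symmetry assumed. For $x\in\mathbb{R}^n$, $\mathcal{A}x^{m-1}\in\mathbb{R}^n$ has components $(\mathcal{A}x^{m-1})_i=\sum_{i_2,\dots,i_m=1}^n a_{ii_2\cdots i_m}x_{i_2}\cdots x_{i_m}$. The diagonal tensor $\mathrm{diag}(d_1,\dots,d_n)$ has entries $d_i$ at position $(i,i,\dots,i)$ and $0$ elsewhere. Inequalities between vectors are componentwise. $\mathcal{A}$ is semi-positive if for each $x\ge 0$, $x\ne 0$, there is $k\in I_n$ with $x_k>0$ and $(\mathcal{A}x^{m-1})_k\ge 0$. For nonempty $J\subset I_n$ with $|J|=r$, $1\le r\le n$,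 the principal sub-tensor $\mathcal{A}^J_r\in T_{m,r}$ is the tensor with entries $a_{i_1\cdots i_m}$, $i_1,\dots,i_m\in J$. For any tensor $\mathcal{A}\in T_{m,n}$, $\beta(\mathcal{A}):=\min_{x\ge 0,\ \|x\|_\infty=1}\ \max_{i\in I_n}x_i(\mathcal{A}x^{m-1})_i$ (for $\mathcal{A}^J_r$ the same definition in dimension $r$), where $\|x\|_\infty=\max_i|x_i|$. $T_{\mathcal{A}}:\mathbb{R}^n\to\mathbb{R}^n$ is $T_{\mathcal{A}}(x)=\|x\|_2^{2-m}\mathcal{A}x^{m-1}$ for $x\ne 0$ and $T_{\mathcal{A}}(0)=0$. When $m$ is even, $F_{\mathcal{A}}:\mathbb{R}^n\to\mathbb{R}^n$ is $F_{\mathcal{A}}(x)=(\mathcal{A}x^{m-1})^{[\frac1{m-1}]}$, the componentwise real $(m-1)$-th root. For a continuous positively homogeneous operator $T$ on $\mathbb{R}^n$, $\|T\|_\infty:=\max_{\|x\|_\infty=1}\|T(x)\|_\infty$. *)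

(* Defs.v *)
From mathcomp Require Import all_boot all_order all_algebra.
From mathcomp Require Import all_classical all_reals all_analysis.

Set Implicit Arguments.
Unset Strict Implicit.
Unset Printing Implicit Defensive.

Import Order.TTheory GRing.Theory Num.Theory.
Import numFieldNormedType.Exports.

Local Open Scope classical_set_scope.
Local Open Scope ring_scope.

(* Indices range over ['I_n] = {0, ..., n-1}, vectors of R^n are row vectors,
   and [`|x|] is the library norm of ['rV[R]_n], the sup norm max_i |x_i|. *)

Notation tensor R m n := {ffun m.-tuple 'I_n -> R}.

Section Tensors.
Variable R : realType.

(* (A x^{m-1})_i sums over the positions (i_1, ..., i_m) with i_1 = i. *)
Definition tapply m n (A : tensor R m n) (x : 'rV[R]_n) : 'rV[R]_n :=
  \row_i \sum_(t : m.-tuple 'I_n | ohead t == Some i)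
           A t * \prod_(j <- behead t) x 0 j.

Definition diag_tensor m n (d : 'I_n -> R) : tensor R m n :=
  [ffun t : m.-tuple 'I_n =>
     (if tval t is i :: s then (if all (pred1 i) s then d i else 0) else 0) : R].

Definition nneg n (x : 'rV[R]_n) : Prop := forall i, 0 <= x 0 i.

Definition semi_positive m n (A : tensor R m n) : Prop :=
  forall x : 'rV[R]_n, nneg x -> x != 0 ->
    exists k, 0 < x 0 k /\ 0 <= tapply A x 0 k.

(* [enum_val : 'I_#|J| -> 'I_n] enumerates J in increasing order. *)
Definition subtensor m n (A : tensor R m n) (J : {set 'I_n}) : tensor R m #|J| :=
  [ffun t : m.-tuple 'I_#|J| => A (map_tuple (@enum_val _ (mem J)) t)].

Definition maxcoord n (f : 'I_n -> R) : R := sup (range f).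

Definition beta_obj m n (A : tensor R m n) (x : 'rV[R]_n) : R :=
  maxcoord (fun i => x 0 i * tapply A x 0 i).

Definition sphere n : set 'rV[R]_n := [set x | `|x| = 1].

Definition nneg_sphere n : set 'rV[R]_n := [set x | nneg x /\ `|x| = 1].

(* [inf], and [sup] in [maxcoord] and [opnorm], are total; [maxcoordP],
   [betaP], [opnorm_TAP] and [opnorm_FAP] below show that they are an attained
   minimum, resp. attained maxima, when 0 < n (and 2 <= m for [FA]). *)
Definition beta m n (A : tensor R m n) : R :=
  inf [set beta_obj A x | x in @nneg_sphere n].

Definition l2norm n (x : 'rV[R]_n) : R := Num.sqrt (\sum_i x 0 i ^+ 2).

Definition TA m n (A : tensor R m n) (x : 'rV[R]_n) : 'rV[R]_n :=
  if x == 0 then 0 else l2norm x ^ (2 - m%:Z) *: tapply A x.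

(* For odd k, the real k-th root of y, negative y included: see [oddrootK]. *)
Definition oddroot (k : nat) (y : R) : R := Num.sg y * (`|y| `^ (k%:R^-1)).

Definition FA m n (A : tensor R m n) (x : 'rV[R]_n) : 'rV[R]_n :=
  map_mx (oddroot m.-1) (tapply A x).

Definition opnorm n (T : 'rV[R]_n -> 'rV[R]_n) : R :=
  sup [set `|T x| | x in @sphere n].

Lemma powR_rootK k (a : R) : (0 < k)%N -> 0 <= a ->
  (a `^ (k%:R^-1)) ^+ k = a.
Proof.
move=> k0 a0; rewrite -(powR_mulrn _ (powR_ge0 _ _)) -powRrM mulVf.
  exact: powRr1.
by rewrite pnatr_eq0 -lt0n.
Qed.

Lemma normr_oddroot k y : (0 < k)%N -> `|oddroot k y| ^+ k = `|y|.
Proof.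
move=> k0; have kn0 : k%:R != 0 :> R by rewrite pnatr_eq0 -lt0n.
have -> : `|oddroot k y| = `|y| `^ (k%:R^-1).
  rewrite /oddroot normrM normr_sg (ger0_norm (powR_ge0 _ _)).
  have [->|_] := eqVneq y 0; last by rewrite mul1r.
  by rewrite normr0 powR0 ?invr_eq0 // mul0r.
by rewrite -powR_mulrn ?powR_ge0 // -powRrM mulVf // powRr1.
Qed.

Lemma oddrootK k y : odd k -> oddroot k y ^+ k = y.
Proof.
move=> ok; have k0 : (0 < k)%N by case: k ok.
rewrite /oddroot exprMn powR_rootK //.
rewrite [RHS]numEsg; congr (_ * _); rewrite -(odd_double_half k) ok.
rewrite exprD expr1 -muln2 mulnC exprM.
by case: sgrP => _; rewrite ?mul0r // ?sqrrN ?expr1n ?mulr1.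
Qed.

Lemma maxcoord_bigmax n (f : 'I_n -> R) (i0 : 'I_n) :
  maxcoord f = \big[Num.max/f i0]_i f i.
Proof.
have lb i : f i <= \big[Num.max/f i0]_i f i by exact: le_bigmax.
have hs : has_sup (range f).
  by split; [exists (f i0), i0 | exists (\big[Num.max/f i0]_i f i) => _ [i _ <-]].
apply/eqP; rewrite eq_le; apply/andP; split.
  by apply: ge_sup; [exists (f i0), i0 | move=> _ [i _ <-]].
by apply/bigmax_leP; split=> [|i _]; apply: ub_le_sup; 
  [case: hs | exists i0 | case: hs | exists i].
Qed.

Lemma maxcoordP n (f : 'I_n -> R) : (0 < n)%N ->
  (exists i, maxcoord f = f i) /\ (forall i, f i <= maxcoord f).
Proof.
move=> n0; pose i0 := Ordinal n0; rewrite (maxcoord_bigmax f i0).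
split=> [|i]; last exact: le_bigmax.
by apply: (big_ind (fun y => exists i, y = f i)) => [|x y [i ->] [j ->]|i _];
  [exists i0 | rewrite maxEle; case: ifP => _; [exists j | exists i] | exists i].
Qed.

Lemma coord_cont n (i : 'I_n) : continuous (fun x : 'rV[R]_n => x 0 i).
Proof. exact: coord_continuous. Qed.

Lemma sphere_compact n : compact (@sphere n).
Proof.
apply: bounded_closed_compact.
  exists 1; split=> // M M1 x xS; have {}xS : `|x| = 1 by [].
  by rewrite /= xS ltW.
have -> : @sphere n = (fun x : 'rV[R]_n => `|x|) @^-1` [set 1] by [].
by apply: preimage_closed => [x _|]; [exact: norm_continuous | exact: closed_eq].
Qed.

Lemma nneg_sphere_compact n : compact (@nneg_sphere n).
Proof.
apply: subclosed_compact (@sphere_compact n) _; last by move=> x [].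
have -> : @nneg_sphere n =
    (\bigcap_(i in [set: 'I_n]) (fun x : 'rV[R]_n => x 0 i) @^-1` [set y | 0 <= y])
      `&` (fun x : 'rV[R]_n => `|x|) @^-1` [set 1].
  by apply/seteqP; split=> x [h ?]; split=> // i; [move=> _; exact: h|exact: h].
apply: closedI.
  apply: closed_bigI => i _; apply: preimage_closed; last exact: closed_ge.
  by move=> x _; exact: coord_cont.
by apply: preimage_closed => [x _|]; [exact: norm_continuous | exact: closed_eq].
Qed.

Lemma nneg_sphere_neq0 n : (0 < n)%N -> @nneg_sphere n !=set0.
Proof.
case: n => // n _; exists (const_mx 1); split=> [i|]; first by rewrite mxE.
rewrite /Num.norm /= mx_normrE; apply/eqP; rewrite eq_le; apply/andP; split.
  by apply/bigmax_leP; split=> // i _; rewrite mxE normr1.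
by apply: (bigmax_sup (ord0, ord0)) => //; rewrite mxE normr1.
Qed.

Lemma tapply_cont m n (A : tensor R m n) i :
  continuous (fun x : 'rV[R]_n => tapply A x 0 i).
Proof.
under eq_fun do rewrite mxE.
apply: continuous_big => [|t _]; first exact: add_continuous.
move=> x; apply: continuousM; first exact: cst_continuous.
apply: (@continuous_big _ _ _ _ _ _ _) => [|j _]; first exact: mul_continuous.
exact: coord_cont.
Qed.

Lemma bigmax_cont n (I : Type) (s : seq I) (f0 : 'rV[R]_n -> R)
    (f : I -> 'rV[R]_n -> R) :
  continuous f0 -> (forall i, continuous (f i)) ->
  continuous (fun x => \big[Num.max/f0 x]_(i <- s) f i x).
Proof.
move=> cf0 cf; elim: s => [|i s IH].
  have -> // : (fun x => \big[Num.max/f0 x]_(i <- [::]) f i x) = f0.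
  by apply/funext => x; rewrite big_nil.
have -> : (fun x => \big[Num.max/f0 x]_(j <- i :: s) f j x) =
    f i \max (fun x => \big[Num.max/f0 x]_(j <- s) f j x).
  by apply/funext => x; rewrite big_cons.
by move=> x; apply: continuous_max; [exact: cf | exact: IH].
Qed.

Lemma beta_obj_cont m n (A : tensor R m n) : (0 < n)%N ->
  continuous (beta_obj A).
Proof.
move=> n0; pose i0 := Ordinal n0; pose g i (x : 'rV[R]_n) := x 0 i * tapply A x 0 i.
have cg i : continuous (g i).
  by move=> x; apply: continuousM; [exact: coord_cont | exact: tapply_cont].
have -> : beta_obj A = fun x => \big[Num.max/g i0 x]_i g i x.
  by apply/funext => x; exact: maxcoord_bigmax.
exact: bigmax_cont.
Qed.

Lemma betaP m n (A : tensor R m n) : (0 < n)%N ->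
  (exists2 x, nneg_sphere x & beta A = beta_obj A x) /\
  (forall x, nneg_sphere x -> beta A <= beta_obj A x).
Proof.
move=> n0; have [|c cS cmin] := EVT_min_rV (nneg_sphere_neq0 n0)
  (@nneg_sphere_compact n) (f := beta_obj A).
  by apply: continuous_subspaceT; exact: beta_obj_cont.
rewrite inE in cS.
have lbd : lbound [set beta_obj A x | x in @nneg_sphere n] (beta_obj A c).
  by move=> _ [x xS <-]; apply: cmin; rewrite inE.
have hlb x : nneg_sphere x -> beta A <= beta_obj A x.
  by move=> xS; apply: ge_inf; [exists (beta_obj A c) | exists x].
split=> //; exists c => //; apply/eqP; rewrite eq_le hlb //=.
by apply: lb_le_inf => //; exists (beta_obj A c), c.
Qed.

Lemma opnorm_max n (T : 'rV[R]_n -> 'rV[R]_n) c : sphere c ->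
  (forall x, sphere x -> `|T x| <= `|T c|) -> opnorm T = `|T c|.
Proof.
move=> cS cmax; apply/eqP; rewrite eq_le; apply/andP; split.
  by apply: ge_sup; [exists `|T c|, c | move=> _ [x xS <-]; exact: cmax].
apply: ub_le_sup; last by exists c.
by exists `|T c| => _ [x xS <-]; exact: cmax.
Qed.

Lemma normrv_cont n (T : 'rV[R]_n -> 'rV[R]_n) :
  (forall i, continuous (fun x => T x 0 i)) -> continuous (fun x => `|T x|).
Proof.
move=> cT.
have -> : (fun x => `|T x|) =
    fun x => \big[Num.max/0]_(ij : 'I_1 * 'I_n) `|T x ij.1 ij.2|.
  by apply/funext => x; rewrite /Num.norm /= mx_normrE.
apply: bigmax_cont => [|[i j]]; first exact: cst_continuous.
rewrite /= ord1 => x.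
apply: (@continuous_comp _ _ _ (fun x => T x 0 j) Num.norm); first exact: cT.
exact: norm_continuous.
Qed.

Lemma sphere_neq0 n : (0 < n)%N -> @sphere n !=set0.
Proof. by move=> /nneg_sphere_neq0[x [_ x1]]; exists x. Qed.

Lemma l2norm_gt0 n (x : 'rV[R]_n) : x != 0 -> 0 < l2norm x.
Proof.
move=> x0; have /rowP/existsNP[i /eqP xi] : x <> 0 by exact/eqP.
rewrite sqrtr_gt0 (bigD1 i) //= ltr_pwDl //; last first.
  by apply: sumr_ge0 => j _; exact: sqr_ge0.
by rewrite mxE in xi; rewrite exprn_even_gt0.
Qed.

Lemma sphere_nz n (x : 'rV[R]_n) : sphere x -> x != 0.
Proof.
by move=> x1; rewrite -normr_eq0 (x1 : `|x| = 1) oner_eq0.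
Qed.

Lemma l2norm_cont n : continuous (@l2norm n).
Proof.
move=> x; apply: (@continuous_comp _ _ _ (fun x : 'rV[R]_n => \sum_i x 0 i ^+ 2)
  Num.sqrt); last exact: sqrt_continuous.
apply: continuous_big => [|i _]; first exact: add_continuous.
by move=> y; apply: continuousM; exact: coord_cont.
Qed.

Lemma normTA m n (A : tensor R m n) (x : 'rV[R]_n) : sphere x ->
  `|TA A x| = l2norm x ^ (2 - m%:Z) * `|tapply A x|.
Proof.
move=> /sphere_nz x0; rewrite /TA (negbTE x0) normrZ ger0_norm //.
by apply: exprz_ge0; exact/ltW/l2norm_gt0.
Qed.

Lemma opnorm_TAP m n (A : tensor R m n) : (0 < n)%N ->
  (exists2 x, sphere x & opnorm (TA A) = `|TA A x|) /\
  (forall x, sphere x -> `|TA A x| <= opnorm (TA A)).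
Proof.
move=> n0; pose f (x : 'rV[R]_n) := l2norm x ^ (2 - m%:Z) * `|tapply A x|.
have [|c cS cmax] := EVT_max_rV (sphere_neq0 n0) (@sphere_compact n) (f := f).
  apply: continuous_in_subspaceT => x; rewrite inE => xS.
  apply: (@continuousM _ _ (fun x => l2norm x ^ (2 - m%:Z))
    (fun x => `|tapply A x|)); last first.
    by apply: normrv_cont => i; exact: tapply_cont.
  have xn0 : l2norm x != 0 by rewrite gt_eqF // l2norm_gt0 // sphere_nz.
  case: (2 - m%:Z) => k.
    apply: (@continuous_comp _ _ _ (@l2norm n) (fun y => y ^+ k)).
      exact: l2norm_cont.
    exact: exprn_continuous.
  apply: (@continuousV _ _ (fun x => l2norm x ^+ k.+1)).
    by rewrite expf_neq0.
  apply: (@continuous_comp _ _ _ (@l2norm n) (fun y => y ^+ k.+1)).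
    exact: l2norm_cont.
  exact: exprn_continuous.
rewrite inE in cS.
have cmax' x : sphere x -> `|TA A x| <= `|TA A c|.
  by move=> xS; rewrite !normTA //; apply: cmax; rewrite inE.
rewrite (opnorm_max cS cmax'); split=> //; by exists c.
Qed.

Lemma normrv_coord n (x : 'rV[R]_n) i : `|x 0 i| <= `|x|.
Proof.
by rewrite [leRHS]/Num.norm /= mx_normrE; apply: (le_bigmax _ _ (ord0, i)).
Qed.

Lemma normrv_attained n (x : 'rV[R]_n) : (0 < n)%N ->
  exists i, `|x| = `|x 0 i|.
Proof.
move=> n0; have [x0|x0] := eqVneq `|x| 0.
  exists (Ordinal n0); apply/eqP; rewrite eq_le normrv_coord andbT x0.
  exact: normr_ge0.
have [[i j] xE] := mx_norm_neq0 x0; exists j.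
by rewrite [LHS]xE /= ord1.
Qed.

Lemma normFA m n (A : tensor R m n) (x : 'rV[R]_n) : (2 <= m)%N -> (0 < n)%N ->
  `|FA A x| ^+ m.-1 = `|tapply A x|.
Proof.
case: m A => [|[|m]] // A _ n0; apply/eqP; rewrite eq_le; apply/andP; split.
  have [i ->] := normrv_attained (FA A x) n0.
  by rewrite mxE normr_oddroot // normrv_coord.
have [i ->] := normrv_attained (tapply A x) n0.
rewrite -(@normr_oddroot m.+1) //.
rewrite lerXn2r ?nnegrE ?normr_ge0 //.
by have := normrv_coord (FA A x) i; rewrite mxE.
Qed.

Lemma opnorm_FAP m n (A : tensor R m n) : (2 <= m)%N -> (0 < n)%N ->
  (exists2 x, sphere x & opnorm (FA A) = `|FA A x|) /\
  (forall x, sphere x -> `|FA A x| <= opnorm (FA A)).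
Proof.
move=> m2 n0.
have [|c cS cmax] := EVT_max_rV (sphere_neq0 n0) (@sphere_compact n)
    (f := fun x => `|tapply A x|).
  apply: continuous_subspaceT; apply: normrv_cont => i; exact: tapply_cont.
rewrite inE in cS.
have cmax' x : sphere x -> `|FA A x| <= `|FA A c|.
  move=> xS; rewrite -(@ler_pXn2r _ m.-1) ?nnegrE ?normr_ge0 //.
    by rewrite !normFA //; apply: cmax; rewrite inE.
  by case: m m2 {A cmax} => [|[]].
rewrite (opnorm_max cS cmax'); split=> //; by exists c.
Qed.

End Tensors.

(* Main.v *)
Require Import Defs.
From mathcomp Require Import all_boot all_order all_algebra.
From mathcomp Require Import all_classical all_reals all_analysis.

Set Implicit Arguments.
Unset Strict Implicit.
Unset Printing Implicit Defensive.

Import Order.TTheory GRing.Theory Num.Theory.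
Import numFieldNormedType.Exports.

Local Open Scope ring_scope.

(* All four bounds compare the objective max_i x_i (A x^{m-1})_i pointwise on
   the nonnegative unit sphere.  For (ii), a vector of R^J is extended by zero:
   the coordinates outside J contribute 0 to the maximum, which is harmless
   because semi-positivity makes the maximum over J nonnegative.  For (iii) and
   (iv) the objective is at most |A x^{m-1}|, which is l2norm x ^ (m-2) * |T_A x|
   and |F_A x| ^ (m-1), while l2norm x <= sqrt n on the unit sphere. *)

Section Bounds.
Variable R : realType.

Lemma tapplyD m n (A B : tensor R m n) (x : 'rV[R]_n) :
  tapply (A + B) x = tapply A x + tapply B x.
Proof.
apply/rowP => i; rewrite !mxE -big_split; apply: eq_bigr => t _ /=.
by rewrite ffunE mulrDl.
Qed.

Lemma tapply_ge0 m n (A : tensor R m n) (x : 'rV[R]_n) :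
  (forall t, 0 <= A t) -> nneg x -> nneg (tapply A x).
Proof.
move=> A0 x0 i; rewrite mxE; apply: sumr_ge0 => t _.
by rewrite mulr_ge0 //; apply: prodr_ge0.
Qed.

Lemma diag_tensor_ge0 m n (d : 'I_n -> R) : (forall i, 0 <= d i) ->
  forall t, 0 <= diag_tensor m d t.
Proof. by move=> d0 t; rewrite ffunE; case: (tval t) => // i s; case: ifP. Qed.

Lemma maxcoord_le n (f : 'I_n -> R) c : (0 < n)%N ->
  (forall i, f i <= c) -> maxcoord f <= c.
Proof. by move=> n0 fc; have [[i ->] _] := maxcoordP f n0. Qed.

(** Apply the hypothesis at a minimiser [x] for [B]. Orders and dimensions may differ, so that a
    sub-tensor can stand on the right. *)
Lemma le_beta m1 n1 m2 n2 (A : tensor R m1 n1) (B : tensor R m2 n2) :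
  (0 < n1)%N -> (0 < n2)%N ->
  (forall x, nneg_sphere x ->
     exists2 y, nneg_sphere y & beta_obj A y <= beta_obj B x) ->
  beta A <= beta B.
Proof.
move=> n10 n20 AB; have [[x xS ->] _] := betaP B n20.
have [y yS yx] := AB x xS; have [_ /(_ y yS) Ay] := betaP A n10.
exact: le_trans yx.
Qed.

(** Since [|x 0 i| <= 1] on the unit sphere, no product in the objective exceeds the sup norm of
    [tapply A x]. This is the common start of (iii) and (iv). *)
Lemma beta_le_norm_tapply m n (A : tensor R m n) (x : 'rV[R]_n) : (0 < n)%N ->
  nneg_sphere x -> beta A <= `|tapply A x|.
Proof.
move=> n0 xS; have [_ /(_ x xS) /le_trans] := betaP A n0; apply.
apply: maxcoord_le => // i; apply: le_trans (ler_norm _) _; rewrite normrM.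
case: xS => _ x1; rewrite -[leRHS]mul1r -x1.
by apply: ler_pM => //; exact: normrv_coord.
Qed.

Lemma beta_add_diag m n (A : tensor R m n) (d : 'I_n -> R) : (0 < n)%N ->
  (forall i, 0 <= d i) -> beta A <= beta (A + diag_tensor m d).
Proof.
move=> n0 d0; apply: le_beta => // x xS; exists x => //.
apply: maxcoord_le => // i.
have [_ /(_ i)] := maxcoordP
  (fun i => x 0 i * tapply (A + diag_tensor m d) x 0 i) n0.
apply: le_trans; case: xS => x0 _.
rewrite tapplyD [X in _ <= _ * X]mxE mulrDr lerDl mulr_ge0 //.
by apply: tapply_ge0 => //; exact: diag_tensor_ge0.
Qed.

Section Subtensor.
Variables (n : nat) (J : {set 'I_n}).

(** By injectivity of [enum_val] the sum has at most one term; it is empty, hence 0, when [i] is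
    outside [J]. *)
Definition extend0 (x : 'rV[R]_#|J|) : 'rV[R]_n :=
  \row_i \sum_(k | enum_val k == i) x 0 k.

Lemma extend0_val (x : 'rV[R]_#|J|) k : extend0 x 0 (enum_val k) = x 0 k.
Proof.
rewrite mxE (big_pred1 k) // => l /=.
by rewrite (inj_eq enum_val_inj).
Qed.

Lemma extend0_out (x : 'rV[R]_#|J|) i : i \notin J -> extend0 x 0 i = 0.
Proof.
move=> iJ; rewrite mxE big1 // => k /eqP ki.
by case/negP: iJ; rewrite -ki enum_valP.
Qed.

Lemma notin_or_enum_val (i : 'I_n) :
  i \notin J \/ exists k : 'I_#|J|, i = enum_val k.
Proof.
have [iJ|] := boolP (i \in J); last by left.
by right; exists (enum_rank_in iJ i); rewrite enum_rankK_in.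
Qed.

Lemma extend0_nneg_sphere (x : 'rV[R]_#|J|) : (0 < n)%N -> (0 < #|J|)%N ->
  nneg_sphere x -> nneg_sphere (extend0 x).
Proof.
move=> n0 J0 [x0 x1]; split=> [i|].
  by rewrite mxE; apply: sumr_ge0.
rewrite -x1; apply/eqP; rewrite eq_le; apply/andP; split.
  have [i ->] := normrv_attained (extend0 x) n0.
  have [iJ|[k ->]] := notin_or_enum_val i; first by rewrite extend0_out ?normr0.
  by rewrite extend0_val normrv_coord.
have [k ->] := normrv_attained x J0.
by rewrite -extend0_val normrv_coord.
Qed.

(** A tuple that leaves [J] contributes a vanishing product; the tuples inside [J] correspond
    bijectively to tuples over ['I_#|J|]. *)
Lemma tapply_extend0 m (A : tensor R m n) (x : 'rV[R]_#|J|) k :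
  tapply A (extend0 x) 0 (enum_val k) = tapply (subtensor A J) x 0 k.
Proof.
have kJ : enum_val k \in J := enum_valP k.
rewrite !mxE (bigID (fun t : m.-tuple 'I_n => all (mem J) t)) /=.
rewrite [X in _ + X]big1 ?addr0; last first.
  move=> t /andP[/eqP tk tJ].
  (* The head of [t] is [enum_val k], which lies in [J], so the index outside [J] occurs in the tail
     and gives a zero factor. *)
  have [j jt jJ] : exists2 j, j \in behead t & j \notin J.
    apply/allPn; apply: contra tJ.
    by case: (tval t) tk => //= i s [->] ->; rewrite kJ.
  by rewrite (big_rem j) //= extend0_out // mul0r mulr0.
(* [enum_rank_in kJ] inverts [enum_val] only on [J], which suffices because the remaining tuples
   have all entries in [J]. *)
rewrite (reindex_onto (map_tuple (@enum_val _ (mem J)))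
  (map_tuple (enum_rank_in kJ))) /=; last first.
  move=> t /andP[_ /allP tJ]; apply/val_inj => /=.
  rewrite -map_comp map_id_in // => j /tJ jJ /=.
  by rewrite enum_rankK_in.
apply: eq_big => [t|t _].
  rewrite -andbA [X in _ && X](_ : _ = true) ?andbT; last first.
    apply/andP; split; first by apply/allP => _ /mapP[j _ ->]; exact: enum_valP.
    apply/eqP/val_inj => /=; rewrite -map_comp map_id_in // => j _ /=.
    exact: enum_valK_in.
  case: (tval t) => //= i s.
  by rewrite /eq_op /= (inj_eq enum_val_inj).
rewrite ffunE /= behead_map big_map; congr (_ * _).
by apply: eq_bigr => j _; rewrite extend0_val.
Qed.

Lemma beta_subtensor m (A : tensor R m n) : (0 < n)%N -> (0 < #|J|)%N ->
  semi_positive A -> beta A <= beta (subtensor A J).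
Proof.
move=> n0 J0 hA; apply: le_beta => // x xS; exists (extend0 x).
  exact: extend0_nneg_sphere.
have [y0 /sphere_nz yn0] := extend0_nneg_sphere n0 J0 xS.
have [_ obj] := maxcoordP (fun k => x 0 k * tapply (subtensor A J) x 0 k) J0.
apply: maxcoord_le => // i; have [iJ|[k ->]] := notin_or_enum_val i; last first.
  by rewrite extend0_val tapply_extend0; exact: obj.
(* The maximum over [J] must be shown nonnegative. Semi-positivity at the extended vector gives an
   index [j] with positive coordinate, hence in [J]. *)
rewrite extend0_out // mul0r; have [j [yj Aj]] := hA _ y0 yn0.
have [jJ|[k kj]] := notin_or_enum_val j.
  by rewrite extend0_out ?ltxx in yj.
apply: le_trans (obj k); rewrite -tapply_extend0 -kj mulr_ge0 //.
by rewrite -extend0_val -kj ltW.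
Qed.

End Subtensor.

Lemma l2norm_le_sqrt n (x : 'rV[R]_n) : sphere x -> l2norm x <= Num.sqrt n%:R.
Proof.
(* Write [n%:R] as a sum of [n] ones and compare termwise with the squares of the coordinates. *)
move=> x1; rewrite ler_sqrt // -[leRHS]mulr1 mulr_natl -[X in _ *+ X]card_ord.
rewrite -sumr_const; apply: ler_sum => i _.
by rewrite -real_normK ?num_real // exprn_ile1 // -(x1 : `|x| = 1) normrv_coord.
Qed.

Lemma beta_le_opnorm_TA m n (A : tensor R m n) : (2 <= m)%N -> (0 < n)%N ->
  beta A <= n%:R `^ ((m%:R - 2) / 2) * opnorm (TA A).
Proof.
move=> m2 n0; have [x xS] := nneg_sphere_neq0 R n0.
have x1 : sphere x by case: xS.
have l0 := l2norm_gt0 (sphere_nz x1).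
apply: le_trans (beta_le_norm_tapply A n0 xS) _.
(* The integer exponents [m - 2] and [2 - m] cancel because [l2norm x] is nonzero. *)
have -> : `|tapply A x| = l2norm x ^+ (m - 2) * `|TA A x|.
  rewrite normTA // mulrA exprnP -expfzDr ?gt_eqF // -subzn //.
  by rewrite addrA subrK subrr expr0z mul1r.
have -> : n%:R `^ ((m%:R - 2) / 2) = Num.sqrt n%:R ^+ (m - 2) :> R.
  by rewrite -powR12_sqrt // -powR_mulrn ?powR_ge0 // -powRrM mulrC natrB.
have [_ /(_ x x1) Tx] := opnorm_TAP A n0.
apply: ler_pM => //; first by rewrite exprn_ge0 // ltW.
by rewrite lerXn2r ?nnegrE ?sqrtr_ge0 ?l2norm_le_sqrt // ltW.
Qed.

Lemma beta_le_opnorm_FA m n (A : tensor R m n) : (2 <= m)%N -> (0 < n)%N ->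
  beta A <= opnorm (FA A) ^+ m.-1.
Proof.
move=> m2 n0; have [x xS] := nneg_sphere_neq0 R n0.
apply: le_trans (beta_le_norm_tapply A n0 xS) _; case: xS => _ x1.
have [_ /(_ x x1) Fx] := opnorm_FAP A m2 n0.
rewrite -normFA // lerXn2r ?nnegrE //.
exact: le_trans Fx.
Qed.

End Bounds.

Theorem theorem3p1 (R : realType) (m n : nat) (hm : (2 <= m)%N)
    (hn : (1 <= n)%N) (d : 'I_n -> R) (hd : forall i, 0 <= d i)
    (A : tensor R m n) (hA : semi_positive A) :
  [/\ beta A <= beta (A + diag_tensor m d),
      forall J : {set 'I_n}, J != finset.set0 -> beta A <= beta (subtensor A J),
      beta A <= n%:R `^ ((m%:R - 2) / 2) * opnorm (TA A)
    & ~~ odd m -> beta A <= opnorm (FA A) ^+ m.-1].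
Proof.
split=> [|J J0||_].
- exact: beta_add_diag.
- by apply: beta_subtensor => //; rewrite card_gt0.
- exact: beta_le_opnorm_TA.
- exact: beta_le_opnorm_FA.
Qed.
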